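(* Consider an approval vote on a finite set $A$: each ballot is a subset $S\subseteq A$ of approved options; let $v_S\ge0$ be the fraction of votes that approved exactly the set $S$ ($\sum_{S\subseteq A}v_S=1$), and let $\alpha_x=\sum_{S\ni x}v_S$ be the (relative) approval score of $x$. Let $r_x$ ($x\in A$) be the rank-like rates given by the margin-based variant, i.e. the rank-like rates determined by the Llull matrix $$v_{xy}=\sum_{S\ni x,\,S\not\ni y}v_S+\tfrac12\sum_{S\ni x,\,S\ni y}v_S+\tfrac12\sum_{S\not\ni x,\,S\not\ni y}v_S .$$ Then for all $x,y\in A$ with $x\ne y$: $r_x<r_y\iff\alpha_x>\alpha_y$.
   Context: Let $A$ be a finite set with $N$ elements and $\Pi$ the set of ordered pairs $xy$ with $x,y\in A$, $x\ne y$. A relation on $A$ is a subset of $\Pi$. A Llull matrix on $A$ is a family $v=(v_{xy})_{xy\in\Pi}$ with $v_{xy}\in[0,1]$ and $v_{xy}+v_{yx}\le1$. Turnovers: $t_{xy}=v_{xy}+v_{yx}$. Indirect scores: $v^*_{xy}=\max\min_{0\le i<n}v_{x_ix_{i+1}}$, the max being over all paths $x_0x_1\dots x_n$ ($n\ge1$, consecutive elements distinct) with $x_0=x$, $x_n=y$. Put $m^\nu_{xy}=v^*_{xy}-v^*_{yx}$, $\nu=\{xy\in\Pi: m^\nu_{xy}>0\}$, $\hat\nu=\{xy\in\Pi: m^\nu_{xy}\ge0\}$. An admissible order is a (strict) total order $\xi\subseteq\Pi$ with $\nu\subseteq\xi\subseteq\hat\nu$; one always exists. Write $x\succ y$ for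 $xy\in\xi$, $x\succeq y$ for $x\succ y$ or $x=y$, and $x'$ for the immediate successor of $x$ in $\xi$ (for $x$ not last). Given an admissible order $\xi$, the projected scores are obtained as follows. (i) For $x\succ y$: $m^\sigma_{xy}=\min\{m^\nu_{pq}: p\succeq x,\ y\succeq q\}$. (ii) $(t^\sigma_{xy})_{xy\in\Pi}$ is the unique minimizer of $\sum_{xy\in\Pi}(\tau_{xy}-t_{xy})^2$ among all real families $(\tau_{xy})_{xy\in\Pi}$ such that $\tau_{xy}=\tau_{yx}$ for all $xy$; $m^\sigma_{xx'}\le\tau_{xx'}\le1$ for all non-last $x$; $0\le\tau_{xy}-\tau_{xy'}\le m^\sigma_{yy'}$ for all non-last $y$ and all $x\notin\{y,y'\}$. (For the matrix in the claim, which satisfies $v_{xy}+v_{yx}=1$, this gives $t^\sigma_{xy}=1$ for all $xy$.) (iii) $\gamma_{xx'}=[(t^\sigma_{xx'}-m^\sigma_{xx'})/2,\ (t^\sigma_{xx'}+m^\sigma_{xx'})/2]$, and for $x\succ y$, $\gamma_{xy}=\bigcup\{\gamma_{pp'}: x\succeq p\succ y\}$, which is a closed interval. (iv) For $x\succ y$: $v^\pi_{xy}=\max\gamma_{xy}$, $v^\pi_{yx}=\min\gamma_{xy}$. The projected scores do not depend on the choice of $\xi$. Rank-like rates: $r_x=N-\sum_{y\ne x}v^\pi_{xy}$. Margin-based variant: two options about which a ballot gives no information (here, two non-approved options) are treated as tied on that ballot, i.e. half a vote each way; two approved options are also tied. *)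

(* Defs.v *)
From mathcomp Require Import all_boot all_order all_algebra.
From mathcomp Require Import all_classical all_reals.

Set Implicit Arguments.
Unset Strict Implicit.
Unset Printing Implicit Defensive.

Import Order.TTheory GRing.Theory Num.Theory.
Local Open Scope classical_set_scope.
Local Open Scope ring_scope.

(* A family indexed by the ordered pairs of distinct elements of A is
   represented by a function A -> A -> R; its values on the diagonal are junk
   and are never used below. *)

Section CLC.
Variables (R : realType) (A : finType).
Implicit Types (v tau : A -> A -> R) (xi : rel A) (x y : A) (w : {set A} -> R).

Definition turnover v x y : R := v x y + v y x.

(* For p = [:: x_1; ...; x_n] this is the minimum of the v x_i x_{i+1} along
   the path x, x_1, ..., x_n. The entries of a Llull matrix are at most 1, so
   starting the iterated minimum at 1 has no effect for n >= 1. *)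
Definition path_score v x (p : seq A) : R :=
  \big[Num.min/1]_(s <- pairmap v x p) s.

(* The path scores take finitely many values, all of them at most 1, and the
   path [:: y] qualifies for x != y, so that this supremum is a maximum. *)
Definition indirect_score v x y : R :=
  sup [set path_score v x p | p in
        [set p : seq A | [/\ p != [::], path (fun a b => a != b) x p
                           & last x p = y]]].

Definition margin_nu v x y : R := indirect_score v x y - indirect_score v y x.

Definition nu v : rel A := fun x y => (x != y) && (0 < margin_nu v x y).

Definition nu_hat v : rel A := fun x y => (x != y) && (0 <= margin_nu v x y).

Definition strict_total_order xi : Prop :=
  [/\ irreflexive xi, transitive xi & forall x y, x != y -> xi x y || xi y x].

Definition admissible v xi : Prop :=
  [/\ strict_total_order xi, subrel (nu v) xi & subrel xi (nu_hat v)].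

(* xi x y is read "x comes before y". *)
Definition weakly xi : rel A := fun x y => (x == y) || xi x y.

Definition next xi : rel A :=
  fun x y => xi x y && [forall z, ~~ (xi x z && xi z y)].

(* Only used for xi x y; the pair (x, y) is then one of those over which the
   minimum is taken, so it may serve as the initial value. *)
Definition margin_sigma v xi x y : R :=
  \big[Num.min/margin_nu v x y]_(pq : A * A | weakly xi pq.1 x && weakly xi y pq.2)
    margin_nu v pq.1 pq.2.

Definition turnover_feasible v xi tau : Prop :=
  [/\ forall x y, x != y -> tau x y = tau y x,
      forall x x', next xi x x' ->
        margin_sigma v xi x x' <= tau x x' <= 1
    & forall y y', next xi y y' -> forall x, x != y -> x != y' ->
        0 <= tau x y - tau x y' <= margin_sigma v xi y y'].

Definition turnover_dist v tau : R :=
  \sum_(xy : A * A | xy.1 != xy.2)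
    (tau xy.1 xy.2 - turnover v xy.1 xy.2) ^+ 2.

Definition turnover_minimizer v xi tau : Prop :=
  turnover_feasible v xi tau /\
  forall tau', turnover_feasible v xi tau' ->
    turnover_dist v tau <= turnover_dist v tau'.

(* The minimizer is unique off the diagonal; xget selects a representative. *)
Definition turnover_sigma v xi : A -> A -> R :=
  xget (fun _ _ => 0) [set tau | turnover_minimizer v xi tau].

Definition gamma_next v xi x x' : set R :=
  let t := turnover_sigma v xi x x' in
  let m := margin_sigma v xi x x' in
  [set s | (t - m) / 2 <= s <= (t + m) / 2].

Definition gamma v xi x y : set R :=
  \bigcup_(pp in [set pp : A * A |
                   [/\ weakly xi x pp.1, xi pp.1 y & next xi pp.1 pp.2]])
    gamma_next v xi pp.1 pp.2.

(* For x before y, gamma v xi x y is a nonempty finite union of closed bounded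
   intervals, so sup and inf are its maximum and minimum. *)
Definition projected_score v xi x y : R :=
  if xi x y then sup (gamma v xi x y) else inf (gamma v xi y x).

Definition rank_like_rate v xi x : R :=
  #|A|%:R - \sum_(y | y != x) projected_score v xi x y.

(* w S is the fraction of the votes that approve exactly the options in S. *)
Definition approval_vote w : Prop :=
  (forall S, 0 <= w S) /\ \sum_(S : {set A}) w S = 1.

Definition approval_score w x : R := \sum_(S : {set A} | x \in S) w S.

Definition margin_based_matrix w x y : R :=
  \sum_(S : {set A} | (x \in S) && (y \notin S)) w S
  + 2^-1 * (\sum_(S : {set A} | (x \in S) && (y \in S)) w S)
  + 2^-1 * (\sum_(S : {set A} | (x \notin S) && (y \notin S)) w S).

End CLC.

(* Main.v *)
(** Since the turnovers are all 1, [v x y = (1 + alpha x - alpha y) / 2].  A path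
going down from [x] to [y] has an average step no better than the direct one,
and a path going up from [y] to [x] has to cross every gap between consecutive
approval scores in between.  Hence [xi] sorts the options by decreasing [alpha],
[m^sigma x x' = alpha x - alpha x'], and for [x] before [y] the projected scores
of [x y] and [y x] are [(1 + g) / 2] and [(1 - g) / 2], where [g] is the largest
consecutive gap between [x] and [y].  Monotonicity of [g] under enlarging the
interval then compares the rates term by term. *)
Require Import Defs.
From mathcomp Require Import all_boot all_order all_algebra.
From mathcomp Require Import all_classical all_reals.
From mathcomp Require Import ring lra.

Set Implicit Arguments.
Unset Strict Implicit.
Unset Printing Implicit Defensive.

Import Order.TTheory GRing.Theory Num.Theory.
Local Open Scope ring_scope.

Definition score_matrix {R : realType} {A : finType} (alpha : A -> R) (x y : A) : R :=
  (1 + alpha x - alpha y) / 2.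

(** * Path scores and indirect margins *)

Section ScoreMatrix.
Context {R : realType} {A : finType} (alpha : A -> R).
Hypothesis alpha01 : forall x, 0 <= alpha x <= 1.
Local Notation v := (score_matrix alpha).

Lemma path_score_cons (u : A -> A -> R) x y p :
  path_score u x (y :: p) = Num.min (u x y) (path_score u y p).
Proof. by rewrite /path_score /= big_cons. Qed.

Lemma path_score_le1 (u : A -> A -> R) x p : path_score u x p <= 1.
Proof.
elim: p x => [|y p IH] x; first by rewrite /path_score big_nil.
by rewrite path_score_cons ge_min IH orbT.
Qed.

(** A path that starts inside [P] and ends outside has a step leaving [P], and its score is at most
    the score of that step. *)
Lemma path_score_cut (u : A -> A -> R) (P : pred A) c x p :
    (forall a b, P a -> ~~ P b -> u a b <= c) -> P x -> ~~ P (last x p) ->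
  path_score u x p <= c.
Proof.
move=> Pc; elim: p x => [|y p IH] x Px /=; first by rewrite Px.
move=> Pl; rewrite path_score_cons ge_min.
by have [Py|Py] := boolP (P y); [rewrite (IH y) ?orbT|rewrite Pc].
Qed.

(** Every step scoring at least [(1 + c) / 2] lowers [alpha] by at least [c]. As [0 <= c], further
    steps only add to the decrease. *)
Lemma path_score_le_decrease c x p :
    0 <= c -> p != [::] -> (1 + c) / 2 <= path_score v x p ->
  c <= alpha x - alpha (last x p).
Proof.
move=> c0; elim: p x => // y p IH x _.
rewrite path_score_cons le_min => /andP[].
rewrite {1}/score_matrix => cxy /= cyp.
case: p IH cyp => [|z p] IH cyp /=; first by lra.
by have := IH y isT cyp; rewrite /=; lra.
Qed.

Lemma indirect_score_le (u : A -> A -> R) c x y : x != y ->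
    (forall p, p != [::] -> last x p = y -> path_score u x p <= c) ->
  indirect_score u x y <= c.
Proof.
move=> xy H; apply: ge_sup.
  by exists (path_score u x [:: y]), [:: y] => //; split => //=; rewrite xy.
by move=> _ [p [p0 _ lp] <-]; apply: H.
Qed.

Lemma indirect_score_ge (u : A -> A -> R) x y : x != y -> u x y <= 1 ->
  u x y <= indirect_score u x y.
Proof.
move=> xy u1.
have -> : u x y = path_score u x [:: y].
  by rewrite path_score_cons /path_score big_nil min_l.
apply: ub_le_sup; first by exists 1 => _ [p _ <-]; exact: path_score_le1.
by exists [:: y] => //; split => //=; rewrite xy.
Qed.

Lemma score_matrix_le1 x y : v x y <= 1.
Proof.
by have := alpha01 x; have := alpha01 y; rewrite /score_matrix; lra.
Qed.

(** [P] is a cut between [y] and [x]: a step leaving it scores at most [(1 - d) / 2], which bounds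
    all paths from [y] to [x]. From [x] to [y] the direct path suffices. *)
Lemma margin_nu_ge (P : pred A) d x y :
    (forall a b, P a -> ~~ P b -> alpha a + d <= alpha b) -> P y -> ~~ P x ->
  (alpha x - alpha y + d) / 2 <= margin_nu v x y.
Proof.
move=> Pd Py Px.
have yx : y != x by apply: contraNneq Px => <-.
have le1 : v x y <= indirect_score v x y.
  by apply: indirect_score_ge; [rewrite eq_sym|exact: score_matrix_le1].
have le2 : indirect_score v y x <= (1 - d) / 2.
  apply: indirect_score_le => // p _ lp.
  apply: (@path_score_cut _ P) => //; last by rewrite lp.
  by move=> a b Pa Pb; have := Pd a b Pa Pb; rewrite /score_matrix; lra.
by move: le1; rewrite /margin_nu /score_matrix; lra.
Qed.

Lemma margin_nu_le x y : x != y -> alpha y <= alpha x ->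
  margin_nu v x y <= alpha x - alpha y.
Proof.
move=> xy yx.
have le1 : v y x <= indirect_score v y x.
  by apply: indirect_score_ge; [rewrite eq_sym|exact: score_matrix_le1].
have le2 : indirect_score v x y <= v x y.
  apply: indirect_score_le => // p p0 lp; rewrite leNgt; apply/negP => lt.
  (* The constant [c] solves [(1 + c) / 2 = path_score v x p]; a path better than the direct one
     would make it exceed [alpha x - alpha y], hence positive. *)
  have := @path_score_le_decrease (2 * path_score v x p - 1) x p.
  by move: lt; rewrite lp /score_matrix => lt /(_ _ p0 _); lra.
by move: le1 le2; rewrite /margin_nu /score_matrix; lra.
Qed.

Lemma margin_nu_gt0 x y : alpha y < alpha x -> 0 < margin_nu v x y.
Proof.
move=> yx; pose P a := alpha a <= alpha y.
(* The value of [alpha] next above [alpha y] is [alpha z], so leaving the cut [P] costs at least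
   [alpha z - alpha y > 0]. *)
have [z yz zmin] : exists2 z, alpha y < alpha z &
    forall b, alpha y < alpha b -> alpha z <= alpha b.
  by case: (arg_minP (P := fun b => alpha y < alpha b) alpha yx) => z; exists z.
have H : (alpha x - alpha y + (alpha z - alpha y)) / 2 <= margin_nu v x y.
  apply: (@margin_nu_ge P); rewrite /P ?lexx // -?ltNge //.
  by move=> a b ay; rewrite -ltNge => /zmin; lra.
by lra.
Qed.

(** * Admissible orders and immediate successors *)

Section Order.
Variable xi : rel A.
Hypothesis hxi : admissible v xi.

Lemma xi_irr x : xi x x = false.
Proof. by case: hxi => -[]. Qed.

Lemma xi_trans y x z : xi x y -> xi y z -> xi x z.
Proof. by case: hxi => -[_ t _] _ _; exact: t. Qed.

Lemma xi_neq x y : xi x y -> x != y.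
Proof. by apply: contraTneq => ->; rewrite xi_irr. Qed.

Lemma xi_asym x y : xi x y -> xi y x = false.
Proof. by move=> xy; apply/negP => /(xi_trans xy); rewrite xi_irr. Qed.

Lemma xiN x y : ~~ xi x y = weakly xi y x.
Proof.
rewrite /weakly; have [->|yx] := eqVneq y x; first by rewrite xi_irr.
case: hxi => -[_ _ /(_ _ _ yx) tot] _ _.
by apply/idP/idP => [/negPf h|/xi_asym ->]; rewrite ?h ?orbF in tot *.
Qed.

Lemma weakly_trans y x z : weakly xi x y -> weakly xi y z -> weakly xi x z.
Proof.
rewrite /weakly => /orP[/eqP->//|xy] /orP[/eqP<-|/(xi_trans xy) ->];
  by rewrite ?xy orbT.
Qed.

Lemma xi_weakly_trans y x z : xi x y -> weakly xi y z -> xi x z.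
Proof. by move=> xy /orP[/eqP<-//|]; exact: xi_trans. Qed.

Lemma weakly_xi_trans y x z : weakly xi x y -> xi y z -> xi x z.
Proof. by move=> /orP[/eqP->//|]; exact: xi_trans. Qed.

Lemma alpha_weakly x y : weakly xi x y -> alpha y <= alpha x.
Proof.
rewrite -xiN leNgt; apply: contra => lt.
case: hxi => _ + _; apply; rewrite /nu margin_nu_gt0 // andbT.
by apply: contraTneq lt => ->; rewrite ltxx.
Qed.

Lemma alpha_xi x y : xi x y -> alpha y <= alpha x.
Proof. by move=> xy; apply: alpha_weakly; rewrite /weakly xy orbT. Qed.

Lemma next_xi x x' : Defs.next xi x x' -> xi x x'.
Proof. by case/andP. Qed.

Lemma next_weakly x x' y : Defs.next xi x x' -> xi x y -> weakly xi x' y.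
Proof.
by move=> /andP[_ /forallP/(_ y)] + xy; rewrite xy /= xiN.
Qed.

Lemma next_alpha x x' : Defs.next xi x x' -> 0 <= alpha x - alpha x' <= 1.
Proof.
move=> /next_xi/alpha_xi.
by have := alpha01 x; have := alpha01 x'; lra.
Qed.

(** The last element of [P] is the one with the most predecessors in [xi]. *)
Lemma exists_last (P : pred A) x : P x ->
  exists2 p, P p & forall q, P q -> weakly xi q p.
Proof.
move=> Px.
case: (arg_maxnP (P := P) (fun p => #|[pred q | xi q p]|) Px) => p Pp pmax.
exists p => // q Pq; rewrite -xiN; apply/negP => pq.
have := pmax q Pq; rewrite /geq /= leqNgt => /negP; apply; apply: proper_card.
apply/properP; split; first by apply/fintype.subsetP => z; rewrite !inE => /xi_trans; apply.
by exists p; rewrite !inE ?xi_irr.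
Qed.

(** A discrete crossing argument: take the last [p] in [P] from [x] on and before [y]; its successor
    is either [y] or too late to be in [P]. *)
Lemma exists_next (P : pred A) x y : xi x y -> P x -> ~~ P y ->
  exists p p', [/\ weakly xi x p, xi p y, Defs.next xi p p', P p & ~~ P p'].
Proof.
move=> xy Px Py; pose Q := [pred p | [&& weakly xi x p, xi p y & P p]].
have Qx : Q x by rewrite /= /weakly eqxx xy Px.
have [p /and3P[xp py Pp] plast] := exists_last Qx.
(* Among the elements after [p], the one with the fewest predecessors is the immediate successor. *)
case: (arg_minnP (P := xi p) (fun z => #|[pred q | xi q z]|) py) => p' pp' p'min.
have pnext : Defs.next xi p p'.
  rewrite /Defs.next pp'; apply/forallP => z; apply/negP => /andP[pz zp'].
  have := p'min z pz; rewrite leqNgt => /negP; apply; apply: proper_card.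
  apply/properP; split.
    by apply/fintype.subsetP => a; rewrite !inE => /xi_trans; apply.
  by exists z; rewrite !inE ?xi_irr.
exists p, p'; split => //; have /orP[/eqP->//|p'y] := next_weakly pnext py.
apply/negP => Pp'; have /plast : Q p'.
  by rewrite /= p'y Pp' /weakly (weakly_xi_trans xp pp') orbT.
by rewrite -xiN pp'.
Qed.

(** * Projected margins and turnovers *)

(** The elements from [x'] on form a cut whose crossing raises [alpha] by at least
    [alpha x - alpha x'], which bounds every margin in the minimum from below. The pair [(x, x')]
    itself attains the bound. *)
Lemma margin_sigma_next x x' : Defs.next xi x x' ->
  margin_sigma v xi x x' = alpha x - alpha x'.
Proof.
move=> xx'; have xix := next_xi xx'.
have le_nu p q : weakly xi p x -> weakly xi x' q ->
    alpha x - alpha x' <= margin_nu v p q.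
  move=> px xq.
  have le1 : (alpha p - alpha q + (alpha x - alpha x')) / 2 <= margin_nu v p q.
    apply: (@margin_nu_ge (weakly xi x')) => //.
      move=> a b /alpha_weakly ax'; rewrite -xiN negbK => bx'.
      suff /alpha_weakly : weakly xi b x by lra.
      rewrite -xiN; apply/negP => xb.
      by have := next_weakly xx' xb; rewrite -xiN bx'.
    by rewrite -xiN negbK (@weakly_xi_trans x).
  by have := alpha_weakly px; have := alpha_weakly xq; lra.
have refl z : weakly xi z z by rewrite /weakly eqxx.
apply/eqP; rewrite eq_le; apply/andP; split.
  apply: le_trans (margin_nu_le (xi_neq xix) (alpha_xi xix)).
  exact: bigmin_le_id.
by apply: le_bigmin => [|[p q] /andP[]]; apply: le_nu.
Qed.

(** The constant family 1 is feasible and at distance 0 from the turnovers. Any minimizer is then at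
    distance 0 too, which determines it off the diagonal. *)
Lemma turnover_sigma1 x y : x != y -> turnover_sigma v xi x y = 1.
Proof.
have t1 a b : turnover v a b = 1.
  by rewrite /turnover /score_matrix; field.
have feas1 : turnover_feasible v xi (fun _ _ => 1).
  split => // [a a' aa'|a a' aa' b _ _].
    by have := next_alpha aa'; rewrite margin_sigma_next //; lra.
  by have := next_alpha aa'; rewrite margin_sigma_next //; lra.
have dist1 : turnover_dist v (fun _ _ => 1) = 0.
  by rewrite /turnover_dist big1 // => ab _; rewrite t1 subrr expr0n.
have min1 : turnover_minimizer v xi (fun _ _ => 1).
  split=> // tau _; rewrite dist1; apply: sumr_ge0 => ab _; exact: sqr_ge0.
have [_ /(_ _ feas1)] : turnover_minimizer v xi (turnover_sigma v xi).
  by apply: (xgetI (fun _ _ => 0)); exact: min1.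
rewrite dist1 => le0 xy.
have ge0 (ab : A * A) : ab.1 != ab.2 ->
    0 <= (turnover_sigma v xi ab.1 ab.2 - turnover v ab.1 ab.2) ^+ 2.
  by move=> _; exact: sqr_ge0.
have eq0 : turnover_dist v (turnover_sigma v xi) = 0.
  by apply/eqP; rewrite eq_le le0; exact: sumr_ge0.
have /eqP := psumr_eq0P ge0 eq0 (i := (x, y)) xy.
by rewrite t1 sqrf_eq0 subr_eq0 => /eqP.
Qed.

(** * Largest consecutive gaps *)

(** The default 0 is harmless, since [alpha] never increases along [xi]. *)
Definition gap (x y : A) : R :=
  \big[Num.max/0]_(pp : A * A |
      [&& weakly xi x pp.1, xi pp.1 y & Defs.next xi pp.1 pp.2])
    (alpha pp.1 - alpha pp.2).

Lemma gap_ge0 x y : 0 <= gap x y.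
Proof. exact: bigmax_ge_id. Qed.

Lemma gap_ge x y p p' : weakly xi x p -> xi p y -> Defs.next xi p p' ->
  alpha p - alpha p' <= gap x y.
Proof.
move=> xp py pp'.
apply: (@le_bigmax_cond _ _ _ _ (p, p') _ (fun pp => alpha pp.1 - alpha pp.2)).
by rewrite /= xp py.
Qed.

Lemma gap_le x y c : 0 <= c ->
    (forall p p', weakly xi x p -> xi p y -> Defs.next xi p p' ->
      alpha p - alpha p' <= c) ->
  gap x y <= c.
Proof.
move=> c0 H; apply: bigmax_le => // -[p p'] /and3P[/= xp py pp'].
exact: H.
Qed.

Lemma gap_mono x' y x y' : weakly xi x' x -> weakly xi y y' ->
  gap x y <= gap x' y'.
Proof.
move=> x'x yy'; apply: gap_le => [|p p' xp py]; first exact: gap_ge0.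
by apply: gap_ge; [exact: weakly_trans xp|exact: xi_weakly_trans yy'].
Qed.

(** Somewhere between [x] and [y] a single step brings [alpha] from above [alpha y] down to it. *)
Lemma gap_gt0 x y : xi x y -> alpha y < alpha x -> 0 < gap x y.
Proof.
move=> xy yx.
have [|p [p' [xp py pp' Pp]]] := exists_next (P := fun p => alpha y < alpha p) xy yx.
  by rewrite ltxx.
by rewrite -leNgt => Pp'; have := gap_ge xp py pp'; lra.
Qed.

Lemma next_eq_alpha x y p p' : alpha x = alpha y -> weakly xi x p -> xi p y ->
  Defs.next xi p p' -> alpha p - alpha p' = 0.
Proof.
move=> xy /alpha_weakly xp py pp'; have := alpha_xi (next_xi pp').
by have := alpha_weakly (next_weakly pp' py); lra.
Qed.

Lemma gap_eq0 x y : alpha x = alpha y -> gap x y = 0.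
Proof.
move=> xy; apply/eqP; rewrite eq_le gap_ge0 andbT; apply: gap_le => // p p' xp py pp'.
by rewrite (@next_eq_alpha x y).
Qed.

(** Moving the right end across a tie only adds steps of size 0. *)
Lemma gap_eqr z x y : alpha x = alpha y -> weakly xi x y -> gap z x = gap z y.
Proof.
move=> axy xy; apply/eqP; rewrite eq_le gap_mono ?/weakly ?eqxx //=.
apply: gap_le => [|p p' zp py pp']; first exact: gap_ge0.
have [px|] := boolP (xi p x); first exact: gap_ge.
by rewrite xiN => xp; rewrite (@next_eq_alpha x y) // gap_ge0.
Qed.

Lemma gap_eql z x y : alpha x = alpha y -> weakly xi x y -> gap x z = gap y z.
Proof.
move=> axy xy; apply/eqP; rewrite eq_le andbC gap_mono ?/weakly ?eqxx //=.
apply: gap_le => [|p p' xp pz pp']; first exact: gap_ge0.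
have [py|] := boolP (xi p y); last by rewrite xiN => yp; exact: gap_ge.
by rewrite (@next_eq_alpha x y) // gap_ge0.
Qed.

(** * Projected scores *)

(** All the intervals in the union are centred at 1/2, so the widest one contains the others. *)
Lemma gammaP x y s : gamma v xi x y s <->
  exists p p', [/\ weakly xi x p, xi p y, Defs.next xi p p' &
    (1 - (alpha p - alpha p')) / 2 <= s <= (1 + (alpha p - alpha p')) / 2].
Proof.
split=> [[[p p'] [/= xp py pp']]|[p [p' [xp py pp' sI]]]].
  rewrite /gamma_next /= margin_sigma_next // turnover_sigma1.
    by exists p, p'.
  exact/xi_neq/next_xi.
exists (p, p') => //=; rewrite /gamma_next /= margin_sigma_next // turnover_sigma1 //.
exact/xi_neq/next_xi.
Qed.

Lemma gamma_bounds x y s : gamma v xi x y s ->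
  (1 - gap x y) / 2 <= s <= (1 + gap x y) / 2.
Proof.
by move=> /gammaP[p [p' [xp py pp']]]; have := gap_ge xp py pp'; lra.
Qed.

Lemma gamma_half x y : xi x y -> gamma v xi x y (1 / 2).
Proof.
move=> xy; have [||p [p' [xp py pp' _ _]]] := exists_next (P := pred1 x) xy.
- exact: eqxx.
- by rewrite /= eq_sym xi_neq.
by apply/gammaP; exists p, p'; split=> //; have := next_alpha pp'; lra.
Qed.

Lemma projected_score_xi x y : xi x y ->
  projected_score v xi x y = (1 + gap x y) / 2.
Proof.
move=> xy; rewrite /projected_score xy.
have half := gamma_half xy.
have le s : gamma v xi x y s -> s <= sup (gamma v xi x y).
  by apply: ub_le_sup; exists ((1 + gap x y) / 2) => r /gamma_bounds/andP[].
apply/eqP; rewrite eq_le; apply/andP; split.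
  by apply: ge_sup => [|r /gamma_bounds/andP[]//]; exists (1 / 2).
(* Solved for [gap], the bound can be checked step by step on the upper ends of the intervals; the
   point 1/2 covers the default 0. *)
suff : gap x y <= 2 * sup (gamma v xi x y) - 1 by lra.
apply: gap_le => [|p p' xp py pp']; first by have := le _ half; lra.
have := next_alpha pp'.
have : gamma v xi x y ((1 + (alpha p - alpha p')) / 2).
  by apply/gammaP; exists p, p'; split=> //; have := next_alpha pp'; lra.
by move/le; lra.
Qed.

Lemma projected_score_xiC x y : xi y x ->
  projected_score v xi x y = (1 - gap y x) / 2.
Proof.
move=> yx; rewrite /projected_score xi_asym //.
have half := gamma_half yx.
have ge s : gamma v xi y x s -> inf (gamma v xi y x) <= s.
  by apply: ge_inf; exists ((1 - gap y x) / 2) => r /gamma_bounds/andP[].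
apply/eqP; rewrite eq_le; apply/andP; split; last first.
  by apply: lb_le_inf => [|r /gamma_bounds/andP[]//]; exists (1 / 2).
suff : gap y x <= 1 - 2 * inf (gamma v xi y x) by lra.
apply: gap_le => [|p p' xp py pp']; first by have := ge _ half; lra.
have : gamma v xi y x ((1 - (alpha p - alpha p')) / 2).
  by apply/gammaP; exists p, p'; split=> //; have := next_alpha pp'; lra.
by move/ge; lra.
Qed.

(** * Comparison of the rates *)

Lemma xi_total x y : x != y -> xi x y || xi y x.
Proof. by case: hxi => -[_ _ t] _ _; exact: t. Qed.

(** If [z] lies outside the stretch from [x] to [y], two nested intervals are compared by
    [gap_mono]. If it lies between, 1/2 separates the two scores. *)
Lemma projected_score_mono x y z : xi x y -> z != x -> z != y ->
  projected_score v xi y z <= projected_score v xi x z.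
Proof.
move=> xy /xi_total + /xi_total.
have wxy : weakly xi x y by rewrite /weakly xy orbT.
have wr u : weakly xi u u by rewrite /weakly eqxx.
case/orP=> [zx|xz].
  have zy := xi_trans zx xy; rewrite !projected_score_xiC // => _.
  by have := @gap_mono z x z y (wr z) wxy; lra.
case/orP=> [zy|yz].
  rewrite projected_score_xiC // projected_score_xi //.
  by have := gap_ge0 x z; have := gap_ge0 z y; lra.
rewrite !projected_score_xi //.
by have := @gap_mono x z y z wxy (wr z); lra.
Qed.

Lemma projected_score_eq x y z : alpha x = alpha y -> xi x y ->
  z != x -> z != y -> projected_score v xi y z = projected_score v xi x z.
Proof.
move=> axy xy /xi_total + /xi_total.
have wxy : weakly xi x y by rewrite /weakly xy orbT.
case/orP=> [zx|xz].
  have zy := xi_trans zx xy; rewrite !projected_score_xiC // => _.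
  by rewrite (@gap_eqr z x y).
case/orP=> [zy|yz]; last by rewrite !projected_score_xi // (@gap_eql z x y).
rewrite projected_score_xiC // projected_score_xi //.
(* Here [z] lies inside the tie, so both scores are 1/2. *)
have xz' := alpha_xi xz; have zy' := alpha_xi zy.
by rewrite !gap_eq0; lra.
Qed.

Lemma rank_like_rateB x y : x != y ->
  rank_like_rate v xi y - rank_like_rate v xi x =
  (projected_score v xi x y - projected_score v xi y x) +
  \sum_(z | (z != x) && (z != y))
    (projected_score v xi x z - projected_score v xi y z).
Proof.
move=> xy; rewrite /rank_like_rate (bigD1 x) //= [X in _ - (_ - X)](bigD1 y) 1?eq_sym //=.
rewrite sumrB [X in _ - (_ + X) - _](eq_bigl (fun z => (z != x) && (z != y))).
  by ring.
by move=> z; rewrite andbC.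
Qed.

(** Strictness comes from the pair [x], [y] alone, which contributes [gap x y]. *)
Lemma rank_like_rate_lt x y : alpha y < alpha x ->
  rank_like_rate v xi x < rank_like_rate v xi y.
Proof.
move=> yx; have xy : xi x y.
  by apply: contraLR yx; rewrite xiN -leNgt; exact: alpha_weakly.
rewrite -subr_gt0 rank_like_rateB ?xi_neq // ltr_pwDl //.
  rewrite projected_score_xi // projected_score_xiC //.
  by have := gap_gt0 xy yx; lra.
by apply: sumr_ge0 => z /andP[zx zy]; rewrite subr_ge0 projected_score_mono.
Qed.

Lemma rank_like_rate_eq x y : alpha x = alpha y ->
  rank_like_rate v xi x = rank_like_rate v xi y.
Proof.
have [->//|xy] := eqVneq x y.
(* Tied options may stand in either order in [xi], and the claim is symmetric. *)
wlog {xy} xy : x y / xi x y => [H|axy].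
  by case/orP: (xi_total xy) => [/H//|/H yx /esym/yx].
apply/esym/eqP; rewrite -subr_eq0 rank_like_rateB ?xi_neq //.
rewrite projected_score_xi // projected_score_xiC // gap_eq0 //.
rewrite big1 => [|z /andP[zx zy]]; first by apply/eqP; lra.
by rewrite (@projected_score_eq x y) // subrr.
Qed.

End Order.
End ScoreMatrix.

(** * From ballots to approval scores *)

Section ApprovalVote.
Context {R : realType} {A : finType} (w : {set A} -> R).
Hypothesis hw : approval_vote w.

Lemma approval_score01 x : 0 <= approval_score w x <= 1.
Proof.
case: hw => w0 w1; rewrite /approval_score sumr_ge0 //= -w1.
by rewrite [leRHS](bigID (fun S : {set A} => x \in S)) /= lerDl sumr_ge0.
Qed.

(** Both sides are the same combination of the four ballot classes [B b c]. On the diagonal both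
    equal 1/2, so the functions agree everywhere. *)
Lemma margin_based_matrixE :
  margin_based_matrix w = score_matrix (approval_score w).
Proof.
apply/funext => x; apply/funext => y.
rewrite /margin_based_matrix /score_matrix /approval_score.
(* The 1 becomes the total weight, so that it splits into ballot classes as well. *)
rewrite -[X in _ = (X + _ - _) / _](proj2 hw).
pose B (b c : bool) := \sum_(S : {set A} | ((x \in S) == b) && ((y \in S) == c)) w S.
have splitx b : \sum_(S : {set A} | (x \in S) == b) w S = B b true + B b false.
  rewrite (bigID (fun S : {set A} => y \in S)) /=; congr (_ + _);
    by apply: eq_bigl => S; case: (y \in S).
have splity : \sum_(S : {set A} | y \in S) w S = B true true + B false true.
  rewrite (bigID (fun S : {set A} => x \in S)) /=; congr (_ + _);
    by apply: eq_bigl => S; case: (x \in S); case: (y \in S).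
have -> : \sum_(S : {set A}) w S =
    \sum_(S : {set A} | (x \in S) == true) w S +
    \sum_(S : {set A} | (x \in S) == false) w S.
  rewrite (bigID (fun S : {set A} => x \in S)) /=; congr (_ + _);
    by apply: eq_bigl => S; case: (x \in S).
have -> : \sum_(S : {set A} | x \in S) w S =
    \sum_(S : {set A} | (x \in S) == true) w S.
  by apply: eq_bigl => S; rewrite eqb_id.
have -> : \sum_(S : {set A} | (x \in S) && (y \notin S)) w S = B true false.
  by apply: eq_bigl => S; rewrite eqb_id eqbF_neg.
have -> : \sum_(S : {set A} | (x \in S) && (y \in S)) w S = B true true.
  by apply: eq_bigl => S; rewrite !eqb_id.
have -> : \sum_(S : {set A} | (x \notin S) && (y \notin S)) w S = B false false.
  by apply: eq_bigl => S; rewrite !eqbF_neg.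
by rewrite !splitx splity; field.
Qed.

End ApprovalVote.

Theorem theorem17p4 (R : realType) (A : finType) (w : {set A} -> R)
    (hw : approval_vote w) (xi : rel A)
    (hxi : admissible (margin_based_matrix w) xi) (x y : A) (hxy : x != y) :
  rank_like_rate (margin_based_matrix w) xi x
    < rank_like_rate (margin_based_matrix w) xi y
  <-> approval_score w x > approval_score w y.
Proof.
move: hxi; rewrite margin_based_matrixE // => hxi.
have a01 := approval_score01 hw.
split=> [lt|]; last exact: rank_like_rate_lt.
(* The opposite inequality would reverse the rates, and a tie would make them equal. *)
case: ltgtP => // [a_lt|a_eq].
  by have := rank_like_rate_lt a01 hxi a_lt; rewrite ltNge ltW.
by move: lt; rewrite (@rank_like_rate_eq _ _ _ a01 _ hxi x y) ?ltxx.
Qed.
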